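(* Let $n\ge1$, $\alpha>0$, $\lambda>0$, $\beta>1$, let $D=\operatorname{diag}(d_1,\ldots,d_n)$ be a positive definite diagonal matrix (i.e. $d_i>0$ for all $i$), and let $h(x)=\operatorname{MCP}(\|x\|_2;\beta,\lambda)$ on $\mathbb{R}^n$. Suppose that $\alpha<\beta d_{\min}$, where $d_{\min}$ is the smallest value of the diagonal of $D$. The weighted proximal operator of $h$ is given, for every $x\in\mathbb{R}^n$ and every $i\in\{1,\dots,n\}$, by $$\big[\operatorname{prox}_{\alpha h}^{D}(x)\big]_i=\begin{cases}x_i & \text{if }\|x\|_2>\beta\lambda,\\[0.6em] \dfrac{d_i\beta\theta^\star x_i}{(d_i\beta-\alpha)\theta^\star+\alpha\beta\lambda} & \text{if }\|x\|_2\le\beta\lambda\text{ and }\|Dx\|_2>\alpha\lambda,\\[1em] 0 & \text{if }\|x\|_2\le\beta\lambda\text{ and }\|Dx\|_2\le\alpha\lambda,\end{cases}$$ where (in the second case) $\theta^\star>0$ is the unique positive solution of $$\beta^2\sum_{i=1}^n\left[\frac{d_ix_i}{(d_i\beta-\alpha)\theta^\star+\alpha\beta\lambda}\right]^2=1.$$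
   Context: The Minimax Concave Penalty with parameters $\lambda>0$ and $\beta>1$ is $$\operatorname{MCP}(x;\beta,\lambda)=\begin{cases}\lambda|x|-\dfrac{x^2}{2\beta}&\text{if }|x|\le\beta\lambda,\\ \dfrac{\beta\lambda^2}{2}&\text{otherwise,}\end{cases}\qquad x\in\mathbb{R}.$$ For a positive definite matrix $D$, $\|z\|_D^2=\langle z,Dz\rangle$. The weighted proximal operator of a function $h:\mathbb{R}^n\to\mathbb{R}$ with step size $\alpha>0$ is $$\operatorname{prox}_{\alpha h}^{D}(x)=\operatorname*{argmin}_{z\in\mathbb{R}^n}\ \tfrac12\|z-x\|_D^2+\alpha h(z).$$ *)

(* Defs.v *)
(* MathComp: real numbers are an arbitrary [R : realType], vectors of R^n are
   column vectors. *)
From mathcomp Require Import all_boot all_order all_algebra.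
From mathcomp Require Import classical_sets reals.

Set Implicit Arguments.
Unset Strict Implicit.
Unset Printing Implicit Defensive.

Import Order.TTheory GRing.Theory Num.Theory.

Local Open Scope classical_set_scope.
Local Open Scope ring_scope.

Definition inner (R : realType) (n : nat) (u v : 'cV[R]_n) : R :=
  \sum_i u i 0 * v i 0.

(* The norm [`|x|] of a matrix type in MathComp-Analysis is the sup norm, hence
   this separate Euclidean norm. *)
Definition norm2 (R : realType) (n : nat) (x : 'cV[R]_n) : R :=
  Num.sqrt (inner x x).

(* The square of the D-weighted norm, <z, D z>; D is meant to be positive
   definite. *)
Definition wnorm_sq (R : realType) (n : nat) (D : 'M[R]_n) (z : 'cV[R]_n) : R :=
  inner z (D *m z).

Definition MCP (R : realType) (beta lambda x : R) : R :=
  if `|x| <= beta * lambda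
  then lambda * `|x| - x ^+ 2 / (2 * beta)
  else beta * lambda ^+ 2 / 2.

Definition argmin (R : realType) (T : Type) (f : T -> R) : set T :=
  [set z | forall w, f z <= f w].

(* The argmin is kept as a set of minimizers; the operator is single-valued at
   x with value p when [prox D alpha h x = [set p]]. *)
Definition prox (R : realType) (n : nat) (D : 'M[R]_n) (alpha : R)
    (h : 'cV[R]_n -> R) (x : 'cV[R]_n) : set 'cV[R]_n :=
  argmin (fun z => 2^-1 * wnorm_sq D (z - x) + alpha * h z).

(* Over an empty index type there is no least entry, hence the argument [hn]. *)
Definition min_entry (R : realType) (n : nat) (hn : (0 < n)%N)
    (d : 'rV[R]_n) : R :=
  d 0 [arg min_(i < Ordinal hn) d 0 i]%O.

(* Main.v *)
(* Adding [norm2 z ^+ 2 / (2 * beta)] to the penalty makes it a convex function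
   of [norm2 z] (slope [lambda] up to [beta * lambda], then [norm2 z / beta]),
   and since [alpha < beta * d_min], what is left of the weighted quadratic term
   is still strongly convex. Hence a point satisfying the first-order condition
   is the unique minimizer, and it remains to give a subgradient at each
   candidate: [x / beta], [lambda * p / theta] and [D x / alpha]
   respectively. In the middle case the equation for [theta] says that
   [norm2 p = theta]; its left-hand side is [(|D x| / (alpha * lambda)) ^+ 2] at
   [0], is [(|x| / (beta * lambda)) ^+ 2] at [beta * lambda], and is decreasing,
   which yields a unique root and places it in [(0, beta * lambda]]. *)
Require Import Defs.
From mathcomp Require Import all_boot all_order all_algebra.
From mathcomp Require Import classical_sets reals.
From mathcomp Require Import ring lra.

Import Order.TTheory GRing.Theory Num.Theory.

Local Open Scope classical_set_scope.
Local Open Scope ring_scope.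

(** * Euclidean inner product and norm *)

Lemma inner_ge0 (R : realType) (n : nat) (u : 'cV[R]_n) : 0 <= inner u u.
Proof. by apply: sumr_ge0 => i _; rewrite -expr2 sqr_ge0. Qed.

Lemma norm2_ge0 (R : realType) (n : nat) (u : 'cV[R]_n) : 0 <= norm2 u.
Proof. exact: sqrtr_ge0. Qed.

Lemma sqr_norm2 (R : realType) (n : nat) (u : 'cV[R]_n) :
  norm2 u ^+ 2 = inner u u.
Proof. by rewrite sqr_sqrtr ?inner_ge0. Qed.

Lemma norm2_sqr_sum (R : realType) (n : nat) (u : 'cV[R]_n) :
  norm2 u ^+ 2 = \sum_i u i 0 ^+ 2.
Proof. by rewrite sqr_norm2; apply: eq_bigr => i _; rewrite expr2. Qed.

Lemma innerZl (R : realType) (n : nat) (a : R) (u v : 'cV[R]_n) :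
  inner (a *: u) v = a * inner u v.
Proof. by rewrite mulr_sumr; apply: eq_bigr => i _; rewrite mxE mulrA. Qed.

Lemma innerBr (R : realType) (n : nat) (u v w : 'cV[R]_n) :
  inner u (v - w) = inner u v - inner u w.
Proof. by rewrite -sumrB; apply: eq_bigr => i _; rewrite !mxE mulrBr. Qed.

Lemma norm2_eq0 (R : realType) (n : nat) (u : 'cV[R]_n) :
  norm2 u = 0 -> forall i, u i 0 = 0.
Proof.
move=> u0 i; apply/eqP; rewrite -sqrf_eq0.
have /eqP := norm2_sqr_sum R n u; rewrite u0 expr0n eq_sym /= psumr_eq0.
  by move/allP/(_ i (mem_index_enum i)).
by move=> j _; exact: sqr_ge0.
Qed.

(** For nonzero vectors, the squared norm of [norm2 v *: u - norm2 u *: v] is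
    [2 * (norm2 u * norm2 v)] times the difference of the two sides. *)
Lemma cauchy_schwarz (R : realType) (n : nat) (u v : 'cV[R]_n) :
  inner u v <= norm2 u * norm2 v.
Proof.
have [u0|u_neq0] := eqVneq (norm2 u) 0.
  by rewrite u0 mul0r /inner big1 // => i _; rewrite norm2_eq0 // mul0r.
have [v0|v_neq0] := eqVneq (norm2 v) 0.
  by rewrite v0 mulr0 /inner big1 // => i _; rewrite (norm2_eq0 _ _ v) // mulr0.
have uv_gt0 : 0 < norm2 u * norm2 v.
  by rewrite mulr_gt0 // lt_neqAle eq_sym ?u_neq0 ?v_neq0 norm2_ge0.
have : 0 <= \sum_i (norm2 v * u i 0 - norm2 u * v i 0) ^+ 2.
  by apply: sumr_ge0 => i _; rewrite sqr_ge0.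
have -> : \sum_i (norm2 v * u i 0 - norm2 u * v i 0) ^+ 2 =
    norm2 v ^+ 2 * (norm2 u ^+ 2) + norm2 u ^+ 2 * (norm2 v ^+ 2)
    - 2 * (norm2 u * norm2 v) * inner u v.
  rewrite {1}(norm2_sqr_sum _ _ u) {2}(norm2_sqr_sum _ _ v) !mulr_sumr.
  by rewrite -big_split -sumrB; apply: eq_bigr => i _ /=; ring.
move=> H; rewrite -(ler_pM2l uv_gt0); lra.
Qed.

(** * Diagonal weights and the first-order condition *)

Lemma mul_diag_mx_col (R : realType) (n : nat) (d : 'rV[R]_n) (z : 'cV[R]_n) i :
  (diag_mx d *m z) i 0 = d 0 i * z i 0.
Proof. by rewrite mul_diag_mx mxE. Qed.

Lemma min_entry_le (R : realType) (n : nat) (hn : (0 < n)%N) (d : 'rV[R]_n) i :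
  min_entry hn d <= d 0 i.
Proof. by rewrite /min_entry; case: arg_minP => // j _; apply. Qed.

(* Here [g] is a subgradient at [p] of the convex function
   [h + norm2 ^+ 2 / (2 * beta)]; the quadratic term is taken from the weighted
   norm, which stays strongly convex because [alpha < beta * d 0 i]. *)
Lemma prox_eq_set1 (R : realType) (n : nat) (alpha beta : R) (d : 'rV[R]_n)
    (h : 'cV[R]_n -> R) (x p g : 'cV[R]_n) :
    0 < alpha -> 0 < beta -> (forall i, alpha < beta * d 0 i) ->
    (forall z, h p + norm2 p ^+ 2 / (2 * beta) + inner g (z - p) <=
               h z + norm2 z ^+ 2 / (2 * beta)) ->
    (forall i, d 0 i * (p i 0 - x i 0) - alpha / beta * p i 0
               + alpha * g i 0 = 0) ->
  prox (diag_mx d) alpha h x = [set p].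
Proof.
move=> alpha_gt0 beta_gt0 alpha_lt subgrad stationary.
pose F (z : 'cV[R]_n) := 2^-1 * wnorm_sq (diag_mx d) (z - x) + alpha * h z.
pose gap (z : 'cV[R]_n) := \sum_i (d 0 i - alpha / beta) / 2 * (z i 0 - p i 0) ^+ 2.
have coef_gt0 i : 0 < (d 0 i - alpha / beta) / 2.
  by rewrite divr_gt0 // subr_gt0 ltr_pdivrMr // mulrC.
have gap_ge0 (z : 'cV[R]_n) i : 0 <= (d 0 i - alpha / beta) / 2 * (z i 0 - p i 0) ^+ 2.
  by rewrite mulr_ge0 ?sqr_ge0 // ltW.
have F_gap z : F p + gap z <= F z.
  (* The slack of the subgradient inequality accounts for the rest exactly: what remains is linear
     in [z - p], with the stationarity expressions as coefficients. *)
  have -> : F z = F p + gap z + alpha *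
      ((h z + norm2 z ^+ 2 / (2 * beta)) -
       (h p + norm2 p ^+ 2 / (2 * beta) + inner g (z - p))).
    apply/eqP; rewrite -subr_eq0; apply/eqP.
    transitivity (\sum_i (z i 0 - p i 0) *
      (d 0 i * (p i 0 - x i 0) - alpha / beta * p i 0 + alpha * g i 0)); last first.
      by apply: big1 => i _; rewrite stationary mulr0.
    transitivity (2^-1 * wnorm_sq (diag_mx d) (z - x)
      - 2^-1 * wnorm_sq (diag_mx d) (p - x) - gap z
      - alpha / (2 * beta) * norm2 z ^+ 2 + alpha / (2 * beta) * norm2 p ^+ 2
      + alpha * inner g (z - p)).
      by rewrite /F; field; rewrite gt_eqF.
    rewrite !norm2_sqr_sum /wnorm_sq /inner /gap !mulr_sumr.
    rewrite -!sumrB -!big_split /=; apply: eq_bigr => i _.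
    by rewrite !mul_diag_mx_col !mxE; field; rewrite gt_eqF.
  by rewrite lerDl mulr_ge0 ?subr_ge0 // ltW.
apply/seteqP; split=> z /=.
  move=> /(_ p); rewrite -/(F z) -/(F p) => Fz_le.
  have gap0 : gap z = 0.
    apply/eqP; rewrite eq_le sumr_ge0 // andbT.
    by have := F_gap z; lra.
  apply/colP => i; apply/eqP; rewrite -subr_eq0 -sqrf_eq0.
  have /eqP := gap0; rewrite psumr_eq0 // => /allP/(_ i (mem_index_enum i)).
  by rewrite /= mulf_eq0 gt_eqF.
move=> -> w; rewrite -/(F w) -/(F p); apply: le_trans (F_gap w).
by rewrite lerDl sumr_ge0.
Qed.

(** * The penalty convexified by a quadratic, as a function of the radius *)

Section RegularizedMCP.
Variables (R : realType) (beta lambda : R).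
Hypotheses (beta_gt0 : 0 < beta) (lambda_gt0 : 0 < lambda).

Lemma MCP_regular_small (r : R) : 0 <= r -> r <= beta * lambda ->
  MCP beta lambda r + r ^+ 2 / (2 * beta) = lambda * r.
Proof. by move=> r_ge0 r_le; rewrite /MCP ger0_norm // r_le; ring. Qed.

Lemma MCP_regular_large (r : R) : beta * lambda < r ->
  MCP beta lambda r + r ^+ 2 / (2 * beta) =
  beta * lambda ^+ 2 / 2 + r ^+ 2 / (2 * beta).
Proof.
move=> r_gt; rewrite /MCP gtr0_norm ?(lt_trans _ r_gt) ?mulr_gt0 //.
by rewrite leNgt r_gt.
Qed.

(** The line of slope [lambda] coincides with the function up to [beta * lambda]; beyond, the gap is
    a perfect square. It supports the candidates 0 and [p] with [norm2 p = theta]. *)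
Lemma MCP_regular_ge (r : R) : 0 <= r ->
  lambda * r <= MCP beta lambda r + r ^+ 2 / (2 * beta).
Proof.
move=> r_ge0; have [r_le|r_gt] := lerP r (beta * lambda).
  by rewrite MCP_regular_small.
rewrite MCP_regular_large // -subr_ge0.
have -> : beta * lambda ^+ 2 / 2 + r ^+ 2 / (2 * beta) - lambda * r =
    (r - beta * lambda) ^+ 2 / (2 * beta) by field; rewrite gt_eqF.
by rewrite divr_ge0 ?sqr_ge0 // mulr_ge0 ?ltW.
Qed.

(** Tangent line on the quadratic branch, where the slope at [s] is [s / beta]. The explicit gap is
    a square for [r] on the same branch and a product of nonnegative factors on the linear one. *)
Lemma MCP_regular_tangent (r s : R) : 0 <= r -> beta * lambda < s ->
  MCP beta lambda s + s ^+ 2 / (2 * beta) + s / beta * (r - s) <=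
  MCP beta lambda r + r ^+ 2 / (2 * beta).
Proof.
move=> r_ge0 s_gt; rewrite MCP_regular_large // -subr_ge0.
have [r_le|r_gt] := lerP r (beta * lambda).
  rewrite MCP_regular_small //.
  have -> : lambda * r - (beta * lambda ^+ 2 / 2 + s ^+ 2 / (2 * beta)
      + s / beta * (r - s)) =
      (s - beta * lambda) * (s - r + (beta * lambda - r)) / (2 * beta).
    by field; rewrite gt_eqF.
  by rewrite divr_ge0 ?mulr_ge0 ?(ltW beta_gt0) //; lra.
rewrite MCP_regular_large //.
have -> : beta * lambda ^+ 2 / 2 + r ^+ 2 / (2 * beta) -
    (beta * lambda ^+ 2 / 2 + s ^+ 2 / (2 * beta) + s / beta * (r - s)) =
    (r - s) ^+ 2 / (2 * beta) by field; rewrite gt_eqF.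
by rewrite divr_ge0 ?sqr_ge0 // mulr_ge0 ?ltW.
Qed.

End RegularizedMCP.

(** * Existence and uniqueness of the root defining theta *)

Section SecularEquation.
Variables (R : realType) (n : nat) (c a : 'I_n -> R) (b : R).
Hypotheses (a_gt0 : forall i, 0 < a i) (b_gt0 : 0 < b).

Let S (t : R) := \sum_i (c i / (a i * t + b)) ^+ 2.

Let den_gt0 i (t : R) : 0 <= t -> 0 < a i * t + b.
Proof. by move=> t_ge0; rewrite ltr_wpDl // mulr_ge0 // ltW. Qed.

(* Clearing denominators reduces this to the intermediate value theorem for
   polynomials. *)
Lemma secular_exists (y u : R) : 0 <= u -> S u <= y <= S 0 ->
  exists2 t, 0 <= t <= u & S t = y.
Proof.
move=> u_ge0 /andP[Su_le S0_ge].
pose q i : {poly R} := a i *: 'X + b%:P.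
(* This is [y - S t] multiplied by the common denominator, which is positive for [0 <= t], so signs
   and roots agree there. *)
pose P : {poly R} := y *: (\prod_i q i ^+ 2)
  - \sum_i (c i ^+ 2) *: \prod_(j | j != i) q j ^+ 2.
have qE i t : (q i).[t] = a i * t + b by rewrite !hornerE.
have PE t : 0 <= t -> P.[t] = (y - S t) * \prod_i (a i * t + b) ^+ 2.
  move=> t_ge0; rewrite /P hornerD hornerN hornerZ horner_prod horner_sum mulrBl.
  congr (_ * _ - _); first by apply: eq_bigr => i _; rewrite horner_exp qE.
  rewrite mulr_suml; apply: eq_bigr => i _.
  rewrite hornerZ horner_prod [in RHS](bigD1 i) //= mulrA expr_div_n.
  rewrite divfK ?expf_neq0 ?gt_eqF ?den_gt0 //.
  by congr (_ * _); apply: eq_bigr => j _; rewrite horner_exp qE.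
have prod_gt0 t : 0 <= t -> 0 < \prod_i (a i * t + b) ^+ 2.
  by move=> t_ge0; apply: prodr_gt0 => i _; rewrite exprn_gt0 ?den_gt0.
have [] := @poly_ivt R P 0 u u_ge0.
  rewrite !PE // pmulr_lle0 ?prod_gt0 // pmulr_lge0 ?prod_gt0 //.
  by rewrite subr_le0 subr_ge0 S0_ge.
move=> t t_in; have t_ge0 : 0 <= t by case/andP: t_in.
rewrite rootE PE // mulf_eq0 (gt_eqF (prod_gt0 _ t_ge0)) // orbF subr_eq0.
by move=> /eqP yE; exists t.
Qed.

(** Each term decreases, strictly unless [c i = 0]; a nonzero sum has at least one strict term. *)
Lemma secular_decr (s t : R) : 0 <= s -> s < t -> S s != 0 -> S t < S s.
Proof.
move=> s_ge0 s_lt S_neq0; have t_ge0 := le_trans s_ge0 (ltW s_lt).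
have term_lt i : (c i / (a i * t + b)) ^+ 2 <= (c i / (a i * s + b)) ^+ 2
    ?= iff (c i == 0).
  have [->|c_neq0] := eqVneq (c i) 0; first by rewrite !mul0r; apply/leif_refl.
  apply/leifP; rewrite !expr_div_n ltr_pM2l ?exprn_even_gt0 //.
  by rewrite ltf_pV2 ?posrE ?exprn_gt0 ?den_gt0 // ltrXn2r ?nnegrE ?ltW ?den_gt0
    // ltrD2r ltr_pM2l.
have := leif_sum (fun i (_ : true) => term_lt i); rewrite -/(S s) -/(S t) => St.
rewrite (lt_leif St); apply: contra S_neq0 => /forallP c0.
by rewrite /S big1 // => i _; rewrite (eqP (c0 i)) mul0r expr0n.
Qed.

Lemma secular_inj (s t : R) : 0 <= s -> 0 <= t -> S s != 0 -> S s = S t -> s = t.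
Proof.
move=> s_ge0 t_ge0 S_neq0 eqS; case: (ltgtP s t) => // lt_st.
  by have := secular_decr _ _ s_ge0 lt_st S_neq0; rewrite eqS ltxx.
by rewrite eqS in S_neq0; have := secular_decr _ _ t_ge0 lt_st S_neq0;
   rewrite eqS ltxx.
Qed.

End SecularEquation.

(** * The three candidates and their subgradients *)

Theorem theorem2 (R : realType) (n : nat) (hn : (0 < n)%N)
    (alpha lambda beta : R) (d : 'rV[R]_n)
    (halpha : 0 < alpha) (hlambda : 0 < lambda) (hbeta : 1 < beta)
    (hd : forall i, 0 < d 0 i)
    (hstep : alpha < beta * min_entry hn d)
    (x : 'cV[R]_n) :
  let D := diag_mx d in
  let h := fun z : 'cV[R]_n => MCP beta lambda (norm2 z) in
  exists p : 'cV[R]_n,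
    prox D alpha h x = [set p] /\
    [/\ beta * lambda < norm2 x ->
          forall i, p i 0 = x i 0,
        norm2 x <= beta * lambda -> alpha * lambda < norm2 (D *m x) ->
          exists theta : R,
            unique (fun t : R => 0 < t /\
              beta ^+ 2 * \sum_i (d 0 i * x i 0 /
                ((d 0 i * beta - alpha) * t + alpha * beta * lambda)) ^+ 2 = 1)
              theta /\
            forall i, p i 0 = d 0 i * beta * theta * x i 0 /
              ((d 0 i * beta - alpha) * theta + alpha * beta * lambda) &
        norm2 x <= beta * lambda -> norm2 (D *m x) <= alpha * lambda ->
          forall i, p i 0 = 0].
Proof.
move=> D h.
have beta_gt0 : 0 < beta by exact: lt_trans hbeta.
have alpha_lt i : alpha < beta * d 0 i.
  by apply: lt_le_trans hstep _; rewrite ler_pM2l // min_entry_le.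
have bl_gt0 : 0 < beta * lambda by rewrite mulr_gt0.
have [x_le|x_gt] := lerP (norm2 x) (beta * lambda); last first.
  exists x; split; last by split.
  apply: (@prox_eq_set1 _ _ _ beta _ _ _ _ (beta^-1 *: x)) => // [z|i]; last first.
    by rewrite mxE; field; rewrite gt_eqF.
  apply: le_trans (MCP_regular_tangent _ _ _ _ _ _ _ (norm2_ge0 _ _ z) x_gt) => //.
  rewrite lerD2l innerZl innerBr -sqr_norm2 (mulrC _ beta^-1) -mulrA.
  rewrite ler_pM2l ?invr_gt0 // expr2 mulrBr lerD2r; exact: cauchy_schwarz.
have [Dx_le|Dx_gt] := lerP (norm2 (D *m x)) (alpha * lambda).
  exists 0; split; last by split=> // _ _ i; rewrite mxE.
  have norm0 : norm2 (0 : 'cV[R]_n) = 0.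
    by rewrite /norm2 /inner big1 ?sqrtr0 // => i _; rewrite mxE mul0r.
  apply: (@prox_eq_set1 _ _ _ beta _ _ _ _ (alpha^-1 *: (D *m x)))
    => // [z|i]; last first.
    by rewrite mxE [(_ *: _ : matrix _ _ _) i 0]mxE mul_diag_mx_col; field; rewrite !gt_eqF.
  apply: le_trans (MCP_regular_ge _ _ _ _ _ _ (norm2_ge0 _ _ z)) => //.
  (* The case assumption says that the subgradient has norm at most [lambda], so Cauchy-Schwarz
     gives the bound [lambda * norm2 z]. *)
  rewrite /h norm0 MCP_regular_small ?(ltW bl_gt0) // mulr0 add0r subr0 innerZl.
  rewrite ler_pdivrMl //; apply: le_trans (cauchy_schwarz _ _ _ _) _.
  by rewrite mulrA ler_wpM2r ?norm2_ge0.
pose a i := d 0 i * beta - alpha.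
have a_gt0 i : 0 < a i by rewrite subr_gt0 mulrC.
have b_gt0 : 0 < alpha * beta * lambda by rewrite !mulr_gt0.
pose q i t := a i * t + alpha * beta * lambda.
pose S t := \sum_i (d 0 i * x i 0 / q i t) ^+ 2.
have S_gt1 : 1 < beta ^+ 2 * S 0.
  have -> : beta ^+ 2 * S 0 = (norm2 (D *m x) / (alpha * lambda)) ^+ 2.
    rewrite expr_div_n norm2_sqr_sum mulr_suml mulr_sumr.
    apply: eq_bigr => i _; rewrite mul_diag_mx_col /q mulr0 add0r.
    by field; rewrite !gt_eqF.
  by rewrite exprn_egt1 // ltr_pdivlMr ?mulr_gt0 // mul1r.
have S_le1 : beta ^+ 2 * S (beta * lambda) <= 1.
  have -> : beta ^+ 2 * S (beta * lambda) = (norm2 x / (beta * lambda)) ^+ 2.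
    rewrite expr_div_n norm2_sqr_sum mulr_suml mulr_sumr.
    apply: eq_bigr => i _.
    (* The two [alpha] terms cancel at this point, so the weight [d 0 i] drops out of the quotient
       and [norm2 x] appears. *)
    have -> : q i (beta * lambda) = d 0 i * beta * (beta * lambda).
      by rewrite /q /a; ring.
    by field; rewrite !gt_eqF.
  by rewrite exprn_ile1 // ?divr_ge0 ?norm2_ge0 ?ler_pdivrMr ?mul1r // ltW.
have beta2_gt0 : 0 < beta ^+ 2 by rewrite exprn_gt0.
have [theta] : exists2 t, 0 <= t <= beta * lambda & S t = (beta ^+ 2)^-1.
  apply: secular_exists => //; first exact: ltW.
  rewrite -(ler_pM2l beta2_gt0) -[X in _ && X](ler_pM2l beta2_gt0).
  by rewrite divff ?gt_eqF // S_le1 ltW.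
move=> /andP[theta_ge0 theta_le] S_theta.
(* The strict inequality [S_gt1] excludes a root at 0. *)
have theta_gt0 : 0 < theta.
  rewrite lt_neqAle theta_ge0 andbT; apply/eqP => theta0.
  by move: S_gt1; rewrite theta0 S_theta divff ?gt_eqF // ltxx.
have q_gt0 i : 0 < q i theta by rewrite addr_gt0 ?mulr_gt0.
pose p : 'cV[R]_n := \col_i (d 0 i * beta * theta * x i 0 / q i theta).
have pE i : p i 0 = d 0 i * beta * theta * x i 0 / q i theta by rewrite mxE.
clearbody p.
have norm_p : norm2 p = theta.
  apply/eqP; rewrite -(@eqrXn2 _ 2) ?norm2_ge0 //; apply/eqP.
  rewrite norm2_sqr_sum.
  transitivity (theta ^+ 2 * (beta ^+ 2 * S theta)).
    rewrite !mulr_sumr; apply: eq_bigr => i _.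
    by rewrite pE; field; rewrite gt_eqF.
  by rewrite S_theta divff ?mulr1 // gt_eqF.
exists p; split; last first.
  split=> // _ _.
  exists theta; split; last by move=> i; rewrite pE.
  split; first by split=> //; rewrite -[X in _ * X]/(S theta) S_theta divff ?gt_eqF.
  move=> t [t_gt0 St]; have {}St : S t = (beta ^+ 2)^-1.
    by apply: (mulfI (lt0r_neq0 beta2_gt0)); rewrite St divff ?gt_eqF.
  apply: (@secular_inj _ _ (fun i => d 0 i * x i 0) a) b_gt0 _ _ _ _ _ _ => //.
  - exact: ltW.
  - by rewrite -/(S theta) S_theta invr_neq0 ?gt_eqF.
  - by rewrite -/(S theta) -/(S t) S_theta St.
apply: (@prox_eq_set1 _ _ _ beta _ _ _ _ ((lambda / theta) *: p))
  => // [z|i]; last first.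
  rewrite mxE pE.
  (* With [q i theta] kept as an atom, the stationarity expression factors, and its second factor
     vanishes by the definition of [q]. *)
  transitivity (d 0 i * x i 0 / q i theta *
    (a i * theta + alpha * beta * lambda - q i theta)).
    by rewrite /a; field; rewrite !gt_eqF.
  by rewrite subrr mulr0.
apply: le_trans (MCP_regular_ge _ _ _ _ _ _ (norm2_ge0 _ _ z)) => //.
rewrite /h norm_p MCP_regular_small // innerZl innerBr -sqr_norm2 norm_p.
(* Since [norm2 p = theta], the constant terms cancel and only Cauchy-Schwarz for [p] and [z] is
   left. *)
have -> : lambda * theta + lambda / theta * (inner p z - theta ^+ 2) =
    lambda / theta * inner p z by field; rewrite gt_eqF.
rewrite -mulrA ler_pM2l // mulrC ler_pdivrMr // mulrC -norm_p.
exact: cauchy_schwarz.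
Qed.
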